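(* Let $f\in C^1(\mathbb{R}^n;\mathbb{R}^n)$, with the choices of Step 1 (cells $\mathcal{C}=\{1,\dots,n_0\}$, cell phase spaces, $\sim_{\mathcal{C}}$, generating functions) fixed. The realization procedure yields admissible graphs with the following relations: (1) The network graph $\mathcal{G}_1=(\mathcal{C},\mathcal{E},\sim_{\mathcal{C}},\sim_1)$ of Step 1 and the network graph $\mathcal{G}_2=(\mathcal{C},\mathcal{E},\sim_{\mathcal{C}},\sim_2)$ of Step 2 are unique up to isomorphism. (2) A network graph $\mathcal{G}_4=(\mathcal{C},\mathcal{E},\sim_{\mathcal{C}},\sim_4)$ of Step 4 may be non-isomorphic to another network graph obtained in Step 4, but each such $\mathcal{G}_4$ is ODE-equivalent to some network graph $\mathcal{G}_3=(\mathcal{C},\mathcal{E},\sim_{\mathcal{C}},\sim_3)$ of Step 3. (3) The following hold, where each $\mathcal{G}_k$ is obtained from $\mathcal{G}_{k-1}$ in the procedure: $$\mathcal{L}(\mathcal{G}_4;\mathbb{R}^{n_0})=\mathcal{L}(\mathcal{G}_3;\mathbb{R}^{n_0})\subseteq\mathcal{L}(\mathcal{G}_2;\mathbb{R}^{n_0})\subseteq\mathcal{L}(\mathcal{G}_1;\mathbb{R}^{n_0}).$$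
   Context: Network graphs. A network graph $\mathcal{G}=(\mathcal{C},\mathcal{E},\sim_{\mathcal{C}},\sim_{\mathcal{E}})$ consists of a finite set of cells $\mathcal{C}$ and a finite set of arrows $\mathcal{E}$, with equivalence relations $\sim_{\mathcal{C}},\sim_{\mathcal{E}}$, and head and tail maps $\mathcal{H},\mathcal{T}:\mathcal{E}\to\mathcal{C}$ such that $e_1\sim_{\mathcal{E}}e_2$ implies $\mathcal{H}(e_1)\sim_{\mathcal{C}}\mathcal{H}(e_2)$, $\mathcal{T}(e_1)\sim_{\mathcal{C}}\mathcal{T}(e_2)$. $I(c)=\mathcal{H}^{-1}(c)$; $B(c,d)$ is the set of bijections $I(c)\to I(d)$ preserving $\sim_{\mathcal{E}}$-classes; $c\sim_I d$ (input equivalence) if $B(c,d)\neq\emptyset$ (and $c\sim_{\mathcal C}d$). The adjacency matrix of an edge class $\xi$ is $(A^{\xi}_{\mathcal{G}})_{ij}=|\mathcal{T}^{-1}(j)\cap\mathcal{H}^{-1}(i)\cap\xi|$. An isomorphism of network graphs is a pair of bijections (on cells and on arrows) commuting with heads and tails and preserving and reflecting the relations $\sim_{\mathcal{C}}$ and $\sim_{\mathcal{E}}$. A vector field $f:P\to P$, $P=\prod_cP_c$, is $\mathcal{G}$-admissible (equivalently, $\mathcal{G}$ is an admissible graph for $f$) if for each $c$ there is $\hat f_c$ with $f_c(x)=\hat f_c(x_c,(x_{\mathcal{T}(e)})_{e\in I(c)})$, such that $\hat f_d(x_d,y)=\hat f_c(x_d,\beta^*y)$ for all $\beta\in B(c,d)$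 and all $(x_d,y)$, where $(\beta^*y)_e=y_{\beta(e)}$. The space of linear admissible vector fields with all cell phase spaces equal to $\mathbb{R}$ is $$\mathcal{L}(\mathcal{G};\mathbb{R}^{n_0})=\Bigl\{\mathrm{diag}(t_1,\dots,t_{n_0})+\sum_{\xi\in\mathcal{E}/\sim_{\mathcal{E}}}\mathrm{diag}(t_1^{\xi},\dots,t_{n_0}^{\xi})A^{\xi}_{\mathcal{G}}: i\sim_I j\Rightarrow t_i=t_j,\ t_i^{\xi}=t_j^{\xi}\Bigr\}.$$ Network graphs $\mathcal{G},\mathcal{G}'$ with $n_0$ cells are ODE-equivalent if and only if there is an input-preserving bijection $\gamma$ from the cells of $\mathcal{G}$ to those of $\mathcal{G}'$ (identified with its permutation matrix) with $\mathcal{L}(\mathcal{G};\mathbb{R}^{n_0})=\gamma^T\mathcal{L}(\mathcal{G}';\mathbb{R}^{n_0})\gamma$; take this as the definition. Realization procedure for $f\in C^1(\mathbb{R}^n;\mathbb{R}^n)$. Step 1. Choose $n_0\le n$, $\mathcal{C}=\{1,\dots,n_0\}$, and nonzero cell phase spaces with $P_1\times\dots\times P_{n_0}=\mathbb{R}^n$. Choose $\sim_{\mathcal{C}}$ such that $c\sim_{\mathcal{C}}d$ implies $P_c=P_d$. For each $c$ choose multiplicities $m_{cd}\ge0$ and a generating function $\hat f_c:P_c\times\prod_{d}(P_d)^{m_{cd}}\to P_c$ with $\partial\hat f_c/\partial y_e\not\equiv0$ for every variable $y_e$ of $\hat f_c$ and $f_c(x)=\hat f_c(x_c,\pi_c(x))$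 for all $x$, where $\pi_c(x)$ lists each $x_d$ repeated $m_{cd}$ times. $\mathcal{E}$ has exactly $m_{cd}$ arrows from $d$ to $c$; the variables of $\hat f_c$ other than the first are $(y_e)_{e\in I(c)}$. The relation $\sim_1$ on $\mathcal{E}$ puts all arrows in distinct classes; distinct cells are not input-equivalent. Step 2. For each $c$ take the unique partition $I(c)=K^1(c)\dot\cup\cdots\dot\cup K^r(c)$ such that $\hat f_c$ is invariant under all permutations of the variables $y_e$, $e\in K^i(c)$, for each $i$; the tails of the arrows in each $K^i(c)$ lie in one $\sim_{\mathcal{C}}$-class; and the parts are maximal with these properties. Set $e\sim_2e'$ iff $e,e'$ lie in the same part of the same $I(c)$. Distinct cells are not input-equivalent. Step 3. For $c\sim_{\mathcal{C}}d$, set $c\sim_I d$ if the parts of $I(c)$ and $I(d)$ can be indexed as $K^1(c),\dots,K^r(c)$ and $K^1(d),\dots,K^r(d)$ with $|K^i(c)|=|K^i(d)|$, so that $\hat f_c$ and $\hat f_d$ coincide as functions when the variables of the $i$-th parts are identified for all $i$. For each input class $Q$ choose such mutually consistent indexings for all cells of $Q$ and set, for $e\in K^i(c)$, $e'\in K^j(d)$: $e\sim_3e'$ iff $c\sim_I d$ and $i=j$. Different choices of indexings may give different $\sim_3$. Step 4. $\sim_4$ is obtained from $\sim_3$ by merging $\sim_3$-classes of arrows whose heads lie in different input classes (subject to the compatibility of heads and tails with $\sim_{\mathcal{C}}$), each merged class containing at most one $\sim_3$-class per input class, and in such a way that the input classes of Step 3 are left unchanged.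
   Formalization: Admissibility is claimed only if ∼_C-equivalent cells without inputs have the same generating function (else the empty map in B(c,d) breaks it); in Step 3, identified variables must also have arrows with ∼_C-equivalent tails, since otherwise G_3 is not a network graph. *)

(* Defs.v *)
From HB Require Import structures.
From mathcomp Require Import all_boot all_order all_fingroup all_algebra.
From mathcomp Require Import all_classical all_reals all_analysis.

Set Implicit Arguments.
Unset Strict Implicit.
Unset Printing Implicit Defensive.

Import Order.TTheory GRing.Theory Num.Theory.
Import numFieldNormedType.Exports.

Local Open Scope ring_scope.

Record network (C : finType) := Network {
  arrow : finType;
  head_of : arrow -> C;
  tail_of : arrow -> C;
  simC : rel C;
  simE : rel arrow
}.

Definition network_graph (C : finType) (G : network C) : Prop :=
  [/\ equivalence_rel (@simC C G),
      equivalence_rel (@simE C G)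
    & forall e e' : arrow G, simE e e' ->
        simC G (head_of e) (head_of e') /\ simC G (tail_of e) (tail_of e')].

Definition inputs (C E : finType) (hd : E -> C) (c : C) : finType :=
  {e : E | hd e == c}.

(* [input_iso G c d b] : b is an element of B(c,d). *)
Definition input_iso (C : finType) (G : network C) (c d : C)
    (b : inputs (@head_of C G) c -> inputs (@head_of C G) d) : Prop :=
  bijective b /\ forall e, simE (val e) (val (b e)).

Definition input_equiv (C : finType) (G : network C) (c d : C) : Prop :=
  simC G c d /\ exists b, @input_iso C G c d b.

Definition isomorphic (C C' : finType) (G : network C) (G' : network C') :
    Prop :=
  exists (g : C -> C') (h : arrow G -> arrow G'),
    [/\ bijective g /\ bijective h,
        forall e, head_of (h e) = g (head_of e),
        forall e, tail_of (h e) = g (tail_of e),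
        forall c d, simC G' (g c) (g d) = simC G c d
      & forall e e', simE (h e) (h e') = simE e e'].

Definition arrow_classes (C : finType) (G : network C) : {set {set arrow G}} :=
  finset.equivalence_partition (@simE C G) [set: arrow G]%SET.

Definition adjacency (R : realType) (n0 : nat) (G : network 'I_n0)
    (xi : {set arrow G}) : 'M[R]_n0 :=
  \matrix_(i, j) #|[set e in xi | (tail_of e == j) && (head_of e == i)]%SET|%:R.

Definition linear_admissible (R : realType) (n0 : nat) (G : network 'I_n0) :
    set 'M[R]_n0 :=
  [set M | exists (t : 'rV[R]_n0) (s : {set arrow G} -> 'rV[R]_n0),
     (forall i j, input_equiv G i j ->
        t 0 i = t 0 j /\
        forall xi, xi \in arrow_classes G -> s xi 0 i = s xi 0 j) /\
     M = diag_mx t +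
         \sum_(xi in arrow_classes G)
            diag_mx (s xi) *m adjacency R xi]%classic.
Arguments linear_admissible R {n0} G.

(* The permutation matrix of g maps the i-th unit column vector to the g(i)-th
   one; it is the transpose of [perm_mx g]. *)
Definition cell_perm_mx (R : realType) (n0 : nat) (g : 'S_n0) : 'M[R]_n0 :=
  (perm_mx g)^T.

Definition ODE_equivalent (R : realType) (n0 : nat) (G G' : network 'I_n0) :
    Prop :=
  exists g : 'S_n0,
    (forall c d, input_equiv G c d <-> input_equiv G' (g c) (g d)) /\
    linear_admissible R G =
      [set (cell_perm_mx R g)^T *m M *m cell_perm_mx R g
        | M in linear_admissible R G']%classic.
Arguments ODE_equivalent R {n0} G G'.

(* The identity between two equal phase spaces R^a and R^b. It is only used
   when a = b holds provably but not by computation. *)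
Definition same_space (R : realType) (a b : nat) (u : 'rV[R]_a) : 'rV[R]_b :=
  conform_mx 0 u.

(* The component x_c of x, where R^n is the product of the R^(k c). *)
Definition cell_state (R : realType) (n0 n : nat) (k : 'I_n0 -> nat)
    (c : 'I_n0) (x : 'rV[R]_n) : 'rV[R]_(k c) :=
  submxrow (same_space (\sum_(d < n0) k d)%N x) c.

Section Pullback.
Variables (R : realType) (n0 : nat) (k : 'I_n0 -> nat) (E : finType).
Variables (hd tl : E -> 'I_n0).

(* The values (y_e) for e in I(c), with y_e in the phase space of T(e). *)
Definition input_state (c : 'I_n0) : Type :=
  forall e : inputs hd c, 'rV[R]_(k (tl (val e))).

Definition input_pullback (c d : 'I_n0) (b : inputs hd c -> inputs hd d)
    (y : input_state d) : input_state c :=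
  fun e => same_space _ (y (b e)).

(* fd(x, y) = fc(x, b^* y) for all x and y *)
Definition agree_along (c d : 'I_n0)
    (fc : 'rV[R]_(k c) -> input_state c -> 'rV[R]_(k c))
    (fd : 'rV[R]_(k d) -> input_state d -> 'rV[R]_(k d))
    (b : inputs hd c -> inputs hd d) : Prop :=
  forall (x : 'rV[R]_(k d)) (y : input_state d),
    fd x y = same_space _ (fc (same_space _ x) (input_pullback b y)).
End Pullback.
Arguments input_state R {n0} k {E} hd tl c.

Definition admissible (R : realType) (n0 n : nat) (k : 'I_n0 -> nat)
    (f : 'rV[R]_n -> 'rV[R]_n) (G : network 'I_n0) : Prop :=
  [/\ (\sum_(c < n0) k c)%N = n,
      forall c d, simC G c d -> k c = k d
    & exists fhat : forall c : 'I_n0, 'rV[R]_(k c) ->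
          input_state R k (@head_of _ G) (@tail_of _ G) c -> 'rV[R]_(k c),
        (forall c x, cell_state k c (f x) =
           fhat c (cell_state k c x)
             (fun e => cell_state k (tail_of (val e)) x))
        /\ forall c d b, simC G c d -> @input_iso _ G c d b ->
             agree_along (fhat c) (fhat d) b].

Definition C1_map (R : realType) (n : nat) (f : 'rV[R]_n -> 'rV[R]_n) : Prop :=
  (forall x, differentiable f x) /\
  forall v, continuous (fun x => 'd f x v).

(* The variables of the generating function of c other than the first one are
   indexed by the pairs (d, j) with j < m c d. *)
Definition gen_var (n0 : nat) (m : 'I_n0 -> 'I_n0 -> nat) (c : 'I_n0) :
    finType :=
  {d : 'I_n0 & 'I_(m c d)}.

(* [gen_diff] and [gen_dep]: for each variable y_v, the partial derivative with
   respect to y_v exists everywhere and is not identically zero. *)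
Record step1_choice (R : realType) (n : nat) (f : 'rV[R]_n -> 'rV[R]_n) :=
  Step1Choice {
    ncell : nat;
    cell_dim : 'I_ncell -> nat;
    dim_gt0 : forall c, (0 < cell_dim c)%N;
    dim_sum : (\sum_(c < ncell) cell_dim c)%N = n;
    cellrel : rel 'I_ncell;
    cellrel_equiv : equivalence_rel cellrel;
    cellrel_dim : forall c d, cellrel c d -> cell_dim c = cell_dim d;
    multiplicity : 'I_ncell -> 'I_ncell -> nat;
    gen_fun : forall c, 'rV[R]_(cell_dim c) ->
      (forall v : gen_var multiplicity c, 'rV[R]_(cell_dim (tag v))) ->
      'rV[R]_(cell_dim c);
    gen_diff : forall c (v : gen_var multiplicity c) (x : 'rV[R]_(cell_dim c))
        (y : forall v' : gen_var multiplicity c, 'rV[R]_(cell_dim (tag v'))),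
      differentiable (fun u => gen_fun x (dfwith y v u)) (y v);
    gen_dep : forall c (v : gen_var multiplicity c),
      exists (x : 'rV[R]_(cell_dim c))
             (y : forall v' : gen_var multiplicity c,
                    'rV[R]_(cell_dim (tag v')))
             (w : 'rV[R]_(cell_dim (tag v))),
        'd (fun u => gen_fun x (dfwith y v u)) (y v) w != 0;
    gen_f : forall c x, cell_state cell_dim c (f x) =
      gen_fun (cell_state cell_dim c x) (fun v => cell_state cell_dim (tag v) x)
  }.

(* An arrow set with exactly [multiplicity c d] arrows from d to c, together
   with the identification of the variables of the generating function of c
   with the arrows in I(c). *)
Record arrow_set (R : realType) (n : nat) (f : 'rV[R]_n -> 'rV[R]_n)
    (D : step1_choice f) := ArrowSet {
  arrows : finType;
  arrow_head : arrows -> 'I_(ncell D);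
  arrow_tail : arrows -> 'I_(ncell D);
  var_arrow : forall c,
    gen_var (@multiplicity _ _ _ D) c -> inputs arrow_head c;
  var_arrow_bij : forall c, bijective (@var_arrow c);
  var_arrow_tail : forall c v, arrow_tail (val (@var_arrow c v)) = tag v
}.

Section Realization.
Variables (R : realType) (n : nat) (f : 'rV[R]_n -> 'rV[R]_n).
Variables (D : step1_choice f) (S : arrow_set D).

Local Notation cell := 'I_(ncell D).
Local Notation inp c := (inputs (@arrow_head _ _ _ _ S) c).
Local Notation ystate c :=
  (input_state R (@cell_dim _ _ _ D)
     (@arrow_head _ _ _ _ S) (@arrow_tail _ _ _ _ S) c).

Definition realization_graph (r : rel (arrows S)) : network cell :=
  Network (@arrow_head _ _ _ _ S) (@arrow_tail _ _ _ _ S) (@cellrel _ _ _ D) r.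

(* The generating function of c as a function of x_c and (y_e), e in I(c). *)
Definition arrow_gen (c : cell) (x : 'rV[R]_(cell_dim c)) (y : ystate c) :
    'rV[R]_(cell_dim c) :=
  gen_fun x (fun v => same_space _ (y (var_arrow S v))).

Definition step1_rel : rel (arrows S) := fun e e' => e == e'.

Definition interchangeable (c : cell) (K : {set inp c}) : Prop :=
  (forall s : {perm inp c}, perm_on K s ->
     agree_along (@arrow_gen c) (@arrow_gen c) s) /\
  forall e e', e \in K -> e' \in K ->
    cellrel (arrow_tail (val e)) (arrow_tail (val e')).

Definition step2_partition (c : cell) (P : {set {set inp c}}) : Prop :=
  finset.partition P [set: inp c]%SET /\
  forall K, K \in P ->
    interchangeable K /\
    forall K' : {set inp c}, K \proper K' -> ~ interchangeable K'.

Definition step2 (r2 : rel (arrows S)) : Prop :=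
  exists P : forall c, {set {set inp c}},
    (forall c, step2_partition (P c)) /\
    forall e e', r2 e e' <->
      exists c K, [/\ K \in P c, e \in [set val a | a in K]%SET
                    & e' \in [set val a | a in K]%SET].

Definition indexed_part (T : finType) (K : seq {set T}) (i : nat) : {set T} :=
  nth finset.set0 K i.

(* K = [:: K^1(c); ...; K^r(c)] lists the parts of I(c) without repetition. *)
Definition indexing (c : cell) (K : seq {set inp c}) : Prop :=
  uniq K /\ step2_partition [set X in K]%SET.

(* Variables are identified only if the tails of their arrows are equivalent
   cells: otherwise [step3] would not yield a network graph. As the
   generating functions are symmetric in each part, it does not matter which
   bijection between the i-th parts is used to identify the variables. *)
Definition consistent (c d : cell) (K : seq {set inp c}) (L : seq {set inp d}) :
    Prop :=
  [/\ size K = size L,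
      forall i, #|indexed_part K i| = #|indexed_part L i|,
      forall i a b, a \in indexed_part K i -> b \in indexed_part L i ->
        cellrel (arrow_tail (val a)) (arrow_tail (val b))
    & forall b : inp c -> inp d, bijective b ->
        (forall i a, a \in indexed_part K i -> b a \in indexed_part L i) ->
        agree_along (@arrow_gen c) (@arrow_gen d) b].

Definition step3_equiv (c d : cell) : Prop :=
  cellrel c d /\
  exists (K : seq {set inp c}) (L : seq {set inp d}),
    [/\ indexing K, indexing L & consistent K L].

Definition step3 (r3 : rel (arrows S)) : Prop :=
  exists K : forall c, seq {set inp c},
    [/\ forall c, indexing (K c),
        forall c d, step3_equiv c d -> consistent (K c) (K d)
      & forall c d (a : inp c) (b : inp d),
          r3 (val a) (val b) <->
          step3_equiv c d /\
          exists i, a \in indexed_part (K c) i /\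
                    b \in indexed_part (K d) i].

(* The third condition says that a class of r4 contains at most one class of r3
   for each input class of the heads. *)
Definition step4 (r3 r4 : rel (arrows S)) : Prop :=
  let G3 := realization_graph r3 in
  let G4 := realization_graph r4 in
  [/\ network_graph G4,
      forall e e', r3 e e' -> r4 e e',
      forall e e', r4 e e' ->
        input_equiv G3 (arrow_head e) (arrow_head e') -> r3 e e'
    & forall c d, input_equiv G4 c d <-> input_equiv G3 c d].

Definition step4_result (r4 : rel (arrows S)) : Prop :=
  exists r3, step3 r3 /\ step4 r3 r4.

End Realization.

(* For cells c, d without inputs, B(c,d) consists of the empty map, so that c
   and d are input-equivalent in every network graph as soon as they are
   equivalent cells. Admissibility then forces their internal dynamics to be
   equal. This holds trivially if no two distinct cells are input-equivalent for
   [step1_rel]. *)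
Definition sources_agree (R : realType) (n : nat) (f : 'rV[R]_n -> 'rV[R]_n)
    (D : step1_choice f) : Prop :=
  forall c d : 'I_(ncell D), cellrel c d ->
    (forall a, multiplicity c a = 0%N) -> (forall a, multiplicity d a = 0%N) ->
    forall (x : 'rV[R]_(cell_dim d)) y y',
      @gen_fun _ _ _ D d x y =
      same_space _ (@gen_fun _ _ _ D c (same_space _ x) y').

(* Main.v *)
Require Import Defs.
From HB Require Import structures.
From mathcomp Require Import all_boot all_order all_fingroup all_algebra.
From mathcomp Require Import all_classical all_reals all_analysis.

Import Order.TTheory GRing.Theory Num.Theory.
Import numFieldNormedType.Exports.

Local Open Scope ring_scope.

(** Everything rests on one relation on the inputs of a cell c: two arrows are
    exchangeable if their tails are equivalent cells and the generating
    function of c is symmetric under the transposition of their two variables.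
    Conjugating transpositions shows that this is an equivalence relation, and
    a permutation preserving its classes is a product of such transpositions,
    so that the classes are exactly the maximal interchangeable sets: the
    partition of Step 2 exists and is unique ([step2_partitionP]). Relabelling
    the arrows respects exchangeability ([relabel_exch]), hence the uniqueness
    of the first two graphs up to isomorphism.

    For Step 3, the indexings are eliminated: c and d are identified if and
    only if there is a bijection of their inputs that preserves tail classes
    and turns one generating function into the other ([step3_equivP]). Such
    bijections can be composed and inverted, and they carry an indexing of one
    cell to a consistent indexing of the other, so that transporting one
    indexing per class gives consistent choices. The graphs of Steps 2 and 3
    are admissible because an input isomorphism between cells with inputs maps
    parts to parts; every input isomorphism of Step 4 is already one of Step 3,
    since its cells are input-equivalent in Step 3 and at most one class per
    input class is merged.

    For the linear spaces, a coefficient for every edge class and every cell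
    amounts to a weight for every arrow, where two weights must agree if the
    arrows are equivalent and their heads are input-equivalent
    ([linear_admissibleP]). Coarsening the arrow relation adds constraints,
    which gives the two inclusions; the arrows newly related in Step 4 have
    heads that are not input-equivalent and add none, which gives the equality.
    As the input classes are also the same, ODE-equivalence holds along the
    identity of the cells.

    Finally, two cells with two and four inputs, each summing its inputs,
    have a single class of inputs each. These two classes may be merged or
    not, and the two results are not isomorphic. *)

Set Implicit Arguments.
Unset Strict Implicit.

(** * Permutations and bijections of finite types *)

Lemma equivalence_relI (T : Type) (r : rel T) :
  reflexive r -> symmetric r -> transitive r -> equivalence_rel r.
Proof.
move=> rr rs rt; apply/equivalence_relP; split=> //.
exact: sym_left_transitive.
Qed.

(** A permutation preserving the classes of an equivalence relation is a
    product of transpositions inside the classes: peeling off the transposition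
    of x and s x makes s x a fixed point and creates no new moved point. *)
Lemma class_perm_ind (T : finType) (r : rel T) (P : {perm T} -> Prop) :
  equivalence_rel r -> P 1%g ->
  (forall x y s, r x y -> P s -> P (tperm x y * s)%g) ->
  forall s : {perm T}, (forall x, r x (s x)) -> P s.
Proof.
move=> /equivalence_relP[rr rl] P1 Pt s.
have [m] := ubnP #|[pred x | s x != x]|; elim: m s => // m IH s sm rs.
have [/existsP[x sx]|/existsPn fs] := boolP [exists x, s x != x]; last first.
  suff -> : s = 1%g by [].
  by apply/permP => x; rewrite perm1; apply/eqP/negPn/fs.
rewrite -[s]mul1g -(tperm2 x (s x)) -mulgA; apply: Pt; first exact: rs.
apply: IH => [|z]; last first.
  rewrite permM; case: tpermP => [->|->|_ _ //].
    by rewrite (rl _ _ (rs x)).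
  by rewrite -(rl _ _ (rs x)).
rewrite -ltnS; apply: leq_trans sm; rewrite ltnS; apply: proper_card.
rewrite properE; apply/andP; split.
  apply/fintype.subsetP => z; rewrite !inE permM.
  by case: tpermP => [->|->|]; rewrite ?eqxx.
apply/subsetPn; exists (s x); rewrite !inE ?permM ?tpermR ?eqxx //.
by rewrite (inj_eq perm_inj).
Qed.

(** Counting fibrewise, the elements of each fibre are matched in the order of
    their enumerations. *)
Lemma fiber_card_bij (T T' : finType) (f : T -> nat) (g : T' -> nat) :
  (forall i, #|[pred x | f x == i]| = #|[pred y | g y == i]|) ->
  exists b : T -> T', bijective b /\ forall x, g (b x) = f x.
Proof.
have inj (U U' : finType) (p : U -> nat) (q : U' -> nat) :
    (forall i, #|[pred x | p x == i]| = #|[pred y | q y == i]|) ->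
    exists b : U -> U', injective b /\ forall x, q (b x) = p x.
  move=> pq.
  have /choice[b bP] : forall x, exists y, q y = p x /\
      index x (enum [pred z | p z == p x]) =
      index y (enum [pred z | q z == p x]).
    move=> x; set s := enum _; set s' := enum _.
    have ss : size s = size s' by rewrite -!cardE pq.
    have xs : (index x s < size s')%N by rewrite -ss index_mem mem_enum inE.
    have [y0 _] : exists y, y \in s'.
      by case: (s') xs => // y ? _; exists y; rewrite mem_head.
    exists (nth y0 s' (index x s)); rewrite index_uniq ?enum_uniq //.
    split=> //.
    by have := mem_nth y0 xs; rewrite mem_enum inE => /eqP.
  exists b; split=> [x x' e|x]; last by have [] := bP x.
  have [qx ix] := bP x; have [qx' ix'] := bP x'.
  have pp : p x = p x' by rewrite -qx -qx' e.
  rewrite -pp -e -ix in ix'.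
  have mem z : p z = p x -> z \in enum [pred z | p z == p x].
    by move=> /eqP pz; rewrite mem_enum inE.
  by rewrite -(nth_index x (mem x erefl)) -ix' nth_index // mem.
move=> fg; have [b [bi gb]] := inj _ _ _ _ fg.
have [b' [bi' _]] := inj _ _ _ _ (fun i => esym (fg i)).
by exists b; split=> //; apply: inj_card_bij (leq_card _ bi').
Qed.

(** * Pulling back response functions along bijections of inputs *)

Section Agreement.
Variables (R : realType) (n0 : nat) (k : 'I_n0 -> nat) (E : finType).
Variables (hd tl : E -> 'I_n0).
Variable F : forall c, 'rV[R]_(k c) -> input_state R k hd tl c -> 'rV[R]_(k c).
Local Notation inp c := (inputs hd c).

Lemma same_space_id a (u : 'rV[R]_a) : same_space a u = u.
Proof. exact: conform_mx_id. Qed.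

Lemma same_space_comp a b c (u : 'rV[R]_a) :
  a = b -> same_space c (same_space b u) = same_space c u.
Proof. by move=> <-; rewrite same_space_id. Qed.

Lemma same_space_cell n (c d : 'I_n0) (x : 'rV[R]_n) :
  c = d -> same_space (k d) (cell_state k c x) = cell_state k d x.
Proof. by move=> ->; rewrite same_space_id. Qed.

(** Along such maps no coordinates are lost, so that pullbacks compose. *)
Definition dim_preserving c d (b : inp c -> inp d) :=
  forall a, k (tl (val a)) = k (tl (val (b a))).

Lemma agree_id c (b : inp c -> inp c) :
  b =1 id -> agree_along (F (c:=c)) (F (c:=c)) b.
Proof.
move=> /funext-> x y; rewrite !same_space_id; congr F.
apply: functional_extensionality_dep => e.
by rewrite /input_pullback same_space_id.
Qed.

Lemma agree_comp c d e (b : inp c -> inp d) (b' : inp d -> inp e) :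
  k c = k d -> k d = k e -> dim_preserving b -> dim_preserving b' ->
  agree_along (F (c:=c)) (F (c:=d)) b -> agree_along (F (c:=d)) (F (c:=e)) b' ->
  agree_along (F (c:=c)) (F (c:=e)) (b' \o b).
Proof.
move=> cd de db db' H H' x y.
rewrite H' H !same_space_comp //; congr (same_space _ (F _ _)).
apply: functional_extensionality_dep => a; rewrite /input_pullback /=.
by rewrite same_space_comp // -db'.
Qed.

Lemma agree_inv c d (b : inp c -> inp d) (b' : inp d -> inp c) :
  k c = k d -> dim_preserving b -> cancel b b' -> cancel b' b ->
  agree_along (F (c:=c)) (F (c:=d)) b -> agree_along (F (c:=d)) (F (c:=c)) b'.
Proof.
move=> cd db bK b'K H x y.
rewrite H !same_space_comp // !same_space_id; congr F.
apply: functional_extensionality_dep => a; rewrite /input_pullback /=.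
rewrite same_space_comp.
  by rewrite (_ : b' (b a) = a) // same_space_id.
by rewrite bK db.
Qed.

End Agreement.

(** * Exchangeable inputs *)

Definition input_of (C E : finType) (hd : E -> C) (e : E) : inputs hd (hd e) :=
  exist _ e (eqxx (hd e)).

(** Replacing c by the head of the arrow avoids transport along the equation
    between them. *)
Lemma inputs_ind (C E : finType) (hd : E -> C)
    (P : forall c, inputs hd c -> Prop) :
  (forall e, P (hd e) (input_of hd e)) -> forall c a, P c a.
Proof.
move=> Pe c [e he]; case: _ / (eqP he) (he) => he'.
by rewrite (bool_irrelevance he' (eqxx _)).
Qed.

Lemma input_head (C E : finType) (hd : E -> C) c (a : inputs hd c) :
  hd (val a) = c.
Proof. exact/eqP/(valP a). Qed.

Section Exchange.
Variables (R : realType) (n : nat) (f : 'rV[R]_n -> 'rV[R]_n).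
Variables (D : step1_choice f) (S : arrow_set D).

Local Notation inp c := (inputs (@arrow_head _ _ _ _ S) c).
Local Notation tl := (@arrow_tail _ _ _ _ S).
Local Notation gen c := (@arrow_gen R n f D S c).
Local Notation "x ~ y" := (@cellrel _ _ _ D x y) (at level 70).

Lemma cellrel_refl c : c ~ c.
Proof. by have [] := (equivalence_relP _).1 (@cellrel_equiv _ _ _ D). Qed.

Lemma cellrel_sym c d : (c ~ d) = (d ~ c).
Proof.
have [rr rl] := (equivalence_relP _).1 (@cellrel_equiv _ _ _ D).
by apply/idP/idP => h; rewrite -(rl _ _ h) rr.
Qed.

Lemma cellrel_trans d c e : c ~ d -> d ~ e -> c ~ e.
Proof.
have [_ rl] := (equivalence_relP _).1 (@cellrel_equiv _ _ _ D).
by move=> /rl ->.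
Qed.

Definition tail_preserving c d (b : inp c -> inp d) :=
  forall a, tl (val a) ~ tl (val (b a)).

Lemma tail_dim c d (b : inp c -> inp d) :
  tail_preserving b -> dim_preserving (@cell_dim _ _ _ D) tl b.
Proof. by move=> h a; apply: cellrel_dim. Qed.

(** The parts of Step 2 are the classes of this relation, which is why they
    exist and are unique. *)
Definition exch c : rel (inp c) := fun a a' =>
  (tl (val a) ~ tl (val a')) && `[< agree_along (gen c) (gen c) (tperm a a') >].

Lemma exchP c (a a' : inp c) : reflect
  (tl (val a) ~ tl (val a') /\ agree_along (gen c) (gen c) (tperm a a'))
  (exch a a').
Proof. by apply: (iffP andP) => -[h] /asboolP. Qed.

Lemma exch_tail c (a a' : inp c) : exch a a' -> tl (val a) ~ tl (val a').
Proof. by case/exchP. Qed.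

Lemma tperm_tail c (a a' : inp c) :
  tl (val a) ~ tl (val a') -> tail_preserving (tperm a a').
Proof.
move=> h x; case: tpermP => [->|->|_ _]; rewrite ?cellrel_refl //.
by rewrite cellrel_sym.
Qed.

Lemma exch_tperm_comp c (a a' : inp c) (s : {perm inp c}) :
  exch a a' -> tail_preserving s -> agree_along (gen c) (gen c) s ->
  agree_along (gen c) (gen c) (tperm a a' * s)%g.
Proof.
move=> /exchP[t g] st sg.
have -> : (tperm a a' * s)%g = (s \o tperm a a') :> (inp c -> inp c).
  by apply/funext => x; rewrite permM.
exact: (agree_comp _ _ (tail_dim (tperm_tail t)) (tail_dim st)).
Qed.

(** Transitivity holds since conjugating the transposition of a and b by that
    of b and c gives the transposition of a and c. *)
Lemma exch_equiv c : equivalence_rel (@exch c).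
Proof.
have rr : reflexive (@exch c).
  move=> a; apply/exchP; split; first exact: cellrel_refl.
  by apply: agree_id => x; rewrite tperm1 perm1.
have sy : symmetric (@exch c).
  suff h (a b : inp c) : exch a b -> exch b a
    by move=> a b; apply/idP/idP; exact: h.
  by move=> /exchP[t g]; apply/exchP; rewrite cellrel_sym tpermC.
suff tr : transitive (@exch c) by exact: equivalence_relI.
move=> b a d ab bd; have [t g] := exchP _ _ ab; have [t' g'] := exchP _ _ bd.
have [<-//|ad] := eqVneq a d; have [->//|nab] := eqVneq a b.
apply/exchP; split; first exact: cellrel_trans t t'.
have -> : tperm a d = (tperm b d * (tperm a b * tperm b d))%g.
  have := tpermJ a b (tperm b d).
  by rewrite tpermL tpermD 1?eq_sym // conjgE tpermV.
apply: exch_tperm_comp => //; last exact: exch_tperm_comp (tperm_tail t') g'.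
move=> x; rewrite permM.
exact: cellrel_trans (tperm_tail t x) (tperm_tail t' _).
Qed.

Lemma exch_refl c (a : inp c) : exch a a.
Proof. by have [] := (equivalence_relP _).1 (@exch_equiv c). Qed.

Lemma exch_sym c (a b : inp c) : exch a b = exch b a.
Proof.
have [rr rl] := (equivalence_relP _).1 (@exch_equiv c).
by apply/idP/idP => h; rewrite -(rl _ _ h) rr.
Qed.

Lemma exch_trans c (b a d : inp c) : exch a b -> exch b d -> exch a d.
Proof.
by have [_ rl] := (equivalence_relP _).1 (@exch_equiv c) => /rl ->.
Qed.

(** This covers the permutations supported in a part as well as those that
    permute every part separately. *)
Lemma exch_perm c (s : {perm inp c}) :
  (forall a, exch a (s a)) -> agree_along (gen c) (gen c) s.
Proof.
suff h : (forall a, exch a (s a)) ->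
  tail_preserving s /\ agree_along (gen c) (gen c) s by case/h.
move: s; apply: class_perm_ind.
- exact: exch_equiv.
- split=> [a|]; first by rewrite perm1 cellrel_refl.
  by apply: agree_id => a; rewrite perm1.
move=> a b s ab [st sg]; split; last exact: exch_tperm_comp.
move=> x; rewrite permM.
exact: cellrel_trans (tperm_tail (exch_tail ab) x) _.
Qed.

Lemma interchangeable_exch c (K : {set inp c}) :
  interchangeable K <-> {in K &, forall a b, exch a b}.
Proof.
split=> [[hs ht] a b aK bK|h].
  apply/exchP; split; first exact: ht.
  apply: hs; apply/fintype.subsetP => x; rewrite !inE.
  by case: tpermP => [->|->|]; rewrite ?eqxx.
split=> [s sK|a b aK bK]; last by apply: exch_tail; apply: h.
apply: exch_perm => a; have [aK|aK] := boolP (a \in K).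
  by apply: h => //; rewrite (perm_closed _ sK).
by rewrite (out_perm sK) // exch_refl.
Qed.

Definition exch_class c (a : inp c) : {set inp c} := [set b | exch a b]%SET.

Definition exch_parts c : {set {set inp c}} :=
  [set exch_class a | a in [set: inp c]]%SET.

Lemma same_part_exch c (a b : inp c) :
  (exists2 K, K \in exch_parts c & a \in K /\ b \in K) <-> exch a b.
Proof.
split=> [[K /imsetP[d _ ->] []]|ab].
  by rewrite !inE => da db; apply: exch_trans db; rewrite exch_sym.
by exists (exch_class a); [exact: imset_f|rewrite !inE exch_refl].
Qed.

Lemma eq_exch_class c (a b : inp c) : exch a b -> exch_class a = exch_class b.
Proof.
move=> ab; apply/setP => d; rewrite !inE.
by have [_ rl] := (equivalence_relP _).1 (@exch_equiv c); rewrite (rl _ _ ab).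
Qed.

(** Every interchangeable set lies in a class, and every class is
    interchangeable, so maximality forces the parts to be the classes. *)
Lemma step2_partitionP c (P : {set {set inp c}}) :
  step2_partition P <-> P = exch_parts c.
Proof.
have class_inter a : interchangeable (exch_class a).
  apply/interchangeable_exch => x y; rewrite !inE => ax ay.
  by apply: exch_trans ay; rewrite exch_sym.
split=> [[/and3P[/eqP covP _ P0] maxP]|->].
  have cls K a : K \in P -> a \in K -> K = exch_class a.
    move=> KP aK; have [/interchangeable_exch iK mK] := maxP _ KP.
    apply/eqP; apply: contrapT => /negP ne; apply: (mK (exch_class a)) => //.
    rewrite finset.properEneq ne; apply/fintype.subsetP => x xK.
    by rewrite inE iK.
  apply/setP => K; apply/idP/imsetP => [KP|[a _ ->]].
    have /set0Pn[a aK] : K != finset.set0 by apply: contraNneq P0 => <-.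
    by exists a => //; apply: cls.
  have : a \in finset.cover P by rewrite covP inE.
  by case/bigcupP => L LP aL; rewrite -(cls _ _ LP aL).
have -> : exch_parts c =
    finset.equivalence_partition (@exch c) [set: inp c]%SET.
  by apply: eq_imset => a; apply/setP => b; rewrite !inE.
split; first by apply: equivalence_partitionP => x y z _ _ _; apply: exch_equiv.
move=> K /imsetP[a _ ->].
have -> : [set y in [set: inp c] | exch a y]%SET = exch_class a.
  by apply/setP => b; rewrite !inE.
split=> // K' /properP[sub [b bK' /negP nb]] iK'; apply: nb; rewrite inE.
move/interchangeable_exch: iK' => iK'; apply: iK' => //.
by apply: (fintype.subsetP sub); rewrite inE exch_refl.
Qed.

Lemma step2P (r2 : rel (arrows S)) : step2 r2 <->
  (forall e e', r2 e e' <->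
     exists c (a b : inp c), [/\ e = val a, e' = val b & exch a b]).
Proof.
have parts_exch e e' : (exists c K, [/\ K \in exch_parts c,
      e \in [set val a | a in K]%SET & e' \in [set val a | a in K]%SET]) <->
    (exists c (a b : inp c), [/\ e = val a, e' = val b & exch a b]).
  split=> [[c [K [KP /imsetP[a aK ->] /imsetP[b bK ->]]]]|].
    by exists c, a, b; split=> //; apply/same_part_exch; exists K.
  move=> [c [a [b [-> -> /same_part_exch[K KP [aK bK]]]]]].
  by exists c, K; split=> //; apply: imset_f.
split=> [[P [PP rP]] e e'|h].
  have PE : P = exch_parts.
    by apply: functional_extensionality_dep => c; apply/step2_partitionP.
  by rewrite PE in rP; apply: (iff_trans (rP e e')).
exists exch_parts; split=> [c|e e']; first exact/step2_partitionP.
by apply: (iff_trans (h e e')); apply: iff_sym.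
Qed.

End Exchange.

(** * Matching the inputs of two cells *)

Section Matching.
Variables (R : realType) (n : nat) (f : 'rV[R]_n -> 'rV[R]_n).
Variables (D : step1_choice f) (S : arrow_set D).

Local Notation cell := 'I_(ncell D).
Local Notation inp c := (inputs (@arrow_head _ _ _ _ S) c).
Local Notation tl := (@arrow_tail _ _ _ _ S).
Local Notation gen c := (@arrow_gen R n f D S c).
Local Notation "x ~ y" := (@cellrel _ _ _ D x y) (at level 70).

Lemma indexing_uniq c (K : seq {set inp c}) : indexing K -> uniq K.
Proof. by case. Qed.

Lemma mem_indexing c (K : seq {set inp c}) X :
  indexing K -> (X \in K) = (X \in exch_parts S c).
Proof. by case=> _ /step2_partitionP <-; rewrite inE. Qed.

Lemma indexing_enum c : indexing (enum (exch_parts S c)).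
Proof.
split; first exact: enum_uniq.
by apply/step2_partitionP/setP => X; rewrite inE mem_enum.
Qed.

Lemma mem_part_size c (K : seq {set inp c}) i a :
  a \in indexed_part K i -> (i < size K)%N.
Proof.
rewrite ltnNge; apply: contraL => h.
by rewrite /indexed_part nth_default // inE.
Qed.

Lemma indexed_part_class c (K : seq {set inp c}) i a :
  indexing K -> a \in indexed_part K i -> indexed_part K i = exch_class a.
Proof.
move=> iK aK; have := mem_nth finset.set0 (mem_part_size aK).
rewrite (mem_indexing _ iK) => /imsetP[b _ Kb].
by move: aK; rewrite /indexed_part Kb inE => /eq_exch_class.
Qed.

Lemma indexed_part_exch c (K : seq {set inp c}) i a b :
  indexing K -> a \in indexed_part K i -> (b \in indexed_part K i) = exch a b.
Proof. by move=> iK /(indexed_part_class iK)->; rewrite inE. Qed.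

Lemma indexed_part_ex c (K : seq {set inp c}) a :
  indexing K -> exists i, a \in indexed_part K i.
Proof.
move=> iK; have : exch_class a \in K by rewrite mem_indexing //; exact: imset_f.
move=> aK; exists (index (exch_class a) K).
by rewrite /indexed_part nth_index // inE exch_refl.
Qed.

Lemma indexed_part_inj c (K : seq {set inp c}) i j a :
  indexing K -> a \in indexed_part K i -> a \in indexed_part K j -> i = j.
Proof.
move=> iK ai aj; apply/eqP.
rewrite -(nth_uniq finset.set0 (mem_part_size ai) (mem_part_size aj)).
  have := indexed_part_class iK aj; rewrite -(indexed_part_class iK ai).
  by rewrite /indexed_part => ->.
exact: indexing_uniq.
Qed.

Lemma agree_part_perm c (K : seq {set inp c}) (b : inp c -> inp c) :
  indexing K -> injective b ->
  (forall i a, a \in indexed_part K i -> b a \in indexed_part K i) ->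
  agree_along (gen c) (gen c) b.
Proof.
move=> iK bi bK; have -> : b = perm bi by apply/funext => a; rewrite permE.
apply: exch_perm => a; rewrite permE; have [i ai] := indexed_part_ex a iK.
by rewrite -(indexed_part_exch _ iK ai) bK.
Qed.

(** The witness for input equivalence in Step 3, freed of the indexings: the
    composites and inverses of such bijections are again of this kind, and each
    of them carries the parts of one cell onto those of the other. *)
Definition input_match c d (b : inp c -> inp d) : Prop :=
  [/\ bijective b, tail_preserving b & agree_along (gen c) (gen d) b].

Lemma match_id c : @input_match c c id.
Proof.
by split; [exists id|move=> a; exact: cellrel_refl|exact: agree_id].
Qed.

Lemma match_comp c d e (b : inp c -> inp d) (b' : inp d -> inp e) :
  c ~ d -> d ~ e -> input_match b -> input_match b' -> input_match (b' \o b).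
Proof.
move=> /cellrel_dim cd /cellrel_dim de [bb bt bg] [bb' bt' bg']; split.
- exact: bij_comp.
- by move=> a; apply: cellrel_trans (bt a) (bt' _).
- exact: agree_comp (tail_dim bt) (tail_dim bt') bg bg'.
Qed.

Lemma match_inv c d (b : inp c -> inp d) (b' : inp d -> inp c) :
  c ~ d -> cancel b b' -> cancel b' b -> input_match b -> input_match b'.
Proof.
move=> /cellrel_dim cd bK b'K [_ bt bg]; split.
- by exists b.
- by move=> a; rewrite cellrel_sym -{2}(b'K a).
- exact: agree_inv (tail_dim bt) bK b'K bg.
Qed.

Lemma match_exch_homo c d (b : inp c -> inp d) a a' :
  c ~ d -> input_match b -> exch a a' -> exch (b a) (b a').
Proof.
move=> cd mb /exchP[t g]; have [[b' bK b'K] bt _] := mb.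
have tt' : tl (val (b a)) ~ tl (val (b a')).
  by apply: cellrel_trans (bt a'); apply: cellrel_trans t; rewrite cellrel_sym.
apply/exchP; split=> //.
have -> : tperm (b a) (b a') = (b \o tperm a a') \o b' :> (inp d -> inp d).
  by apply/funext => x /=; rewrite inj_tperm ?b'K //; exact: can_inj bK.
have mt : input_match (tperm a a').
  by split=> //; [exact/injF_bij/perm_inj|exact: tperm_tail].
have dc : d ~ c by rewrite cellrel_sym.
have [] // := match_comp dc cd (match_inv cd bK b'K mb)
  (match_comp (cellrel_refl c) cd mt mb).
Qed.

Lemma match_exch c d (b : inp c -> inp d) a a' :
  c ~ d -> input_match b -> exch (b a) (b a') = exch a a'.
Proof.
move=> cd mb; apply/idP/idP; last exact: match_exch_homo.
have [[b' bK b'K] _ _] := mb.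
move/(match_exch_homo _ (match_inv cd bK b'K mb)); rewrite !bK.
by rewrite cellrel_sym; apply.
Qed.

Lemma indexed_part_imset c d (b : inp c -> inp d) (K : seq {set inp c}) i :
  indexed_part [seq b @: X | X : {set inp c} <- K] i = b @: indexed_part K i.
Proof.
rewrite /indexed_part; have [h|h] := ltnP i (size K); first exact: nth_map.
by rewrite !nth_default ?size_map // imset0.
Qed.

Lemma match_indexing c d (b : inp c -> inp d) (K : seq {set inp c}) :
  c ~ d -> input_match b -> indexing K ->
  indexing [seq b @: X | X : {set inp c} <- K].
Proof.
move=> cd mb iK; have [[b' bK b'K] _ _] := mb; split.
  rewrite map_inj_uniq ?indexing_uniq //; exact/imset_inj/(can_inj bK).
have imcl a : b @: exch_class a = exch_class (b a).
  apply/setP => x; rewrite -(b'K x) mem_imset ?inE ?match_exch //.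
  exact: can_inj bK.
apply/step2_partitionP/setP => X; rewrite inE; apply/mapP/imsetP.
  move=> [Y]; rewrite mem_indexing // => /imsetP[a _ ->] ->.
  by exists (b a).
move=> [x _ ->]; exists (exch_class (b' x)); last by rewrite imcl b'K.
by rewrite mem_indexing //; exact: imset_f.
Qed.

Lemma match_consistent c d (b : inp c -> inp d) (K : seq {set inp c}) :
  c ~ d -> input_match b -> indexing K ->
  consistent K [seq b @: X | X : {set inp c} <- K].
Proof.
move=> cd mb iK; have [[b' bK b'K] bt bg] := mb.
have bi : injective b := can_inj bK.
split=> [|i|i a x|b1 b1b b1K]; first by rewrite size_map.
- by rewrite indexed_part_imset card_imset.
- rewrite indexed_part_imset => ai /imsetP[a' a'i ->].
  apply: cellrel_trans (bt a'); apply: exch_tail.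
  by rewrite -(indexed_part_exch _ iK ai).
have -> : b1 = b \o (b' \o b1) by apply/funext => a /=; rewrite b'K.
have b'b1 i a : a \in indexed_part K i -> (b' \o b1) a \in indexed_part K i.
  by move/b1K; rewrite indexed_part_imset => /imsetP[a' a'i /= ->]; rewrite bK.
have b'b1i : injective (b' \o b1).
  exact: inj_comp (can_inj b'K) (bij_inj b1b).
have mb' : input_match (b' \o b1).
  split; [exact: injF_bij| |exact: agree_part_perm b'b1].
  move=> a; have [i ai] := indexed_part_ex a iK.
  by apply: exch_tail; rewrite -(indexed_part_exch _ iK ai) b'b1.
by have [] := match_comp (cellrel_refl c) cd mb' mb.
Qed.

Lemma consistent_match c d (K : seq {set inp c}) (L : seq {set inp d}) :
  indexing K -> indexing L -> consistent K L ->
  exists b : inp c -> inp d, input_match b.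
Proof.
move=> iK iL [_ cKL tKL gKL].
have /choice[p pP] a := indexed_part_ex a iK.
have /choice[q qP] a := indexed_part_ex a iL.
have pE a i : (p a == i) = (a \in indexed_part K i).
  by apply/eqP/idP => [<- //|]; apply: indexed_part_inj (pP a).
have qE a i : (q a == i) = (a \in indexed_part L i).
  by apply/eqP/idP => [<- //|]; apply: indexed_part_inj (qP a).
(* p and q send an input to the number of its part *)
have [|b [bb bp]] := @fiber_card_bij _ _ p q.
  move=> i; transitivity #|indexed_part K i|; last rewrite cKL.
    by apply: eq_card => x; rewrite !inE pE.
  by apply: eq_card => x; rewrite !inE qE.
have bKL i a : a \in indexed_part K i -> b a \in indexed_part L i.
  by rewrite -pE -qE bp.
exists b; split; [exact: bb| |exact: gKL].
by move=> a; apply: (tKL (p a)) => //; apply: bKL.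
Qed.

Lemma step3_equivP (c d : cell) : @step3_equiv _ _ _ _ S c d <->
  c ~ d /\ exists b : inp c -> inp d, input_match b.
Proof.
split=> [[cd [K [L [iK iL KL]]]]|[cd [b mb]]]; split=> //.
  exact: consistent_match KL.
have iK := indexing_enum c.
exists (enum (exch_parts S c)).
exists [seq b @: X | X : {set inp c} <- enum (exch_parts S c)].
by split=> //; [exact: match_indexing|exact: match_consistent].
Qed.

Lemma step3_equiv_refl (c : cell) : @step3_equiv _ _ _ _ S c c.
Proof.
by apply/step3_equivP; split; [exact: cellrel_refl|exists id; exact: match_id].
Qed.

Lemma step3_equiv_sym (c d : cell) :
  @step3_equiv _ _ _ _ S c d -> @step3_equiv _ _ _ _ S d c.
Proof.
move=> /step3_equivP[cd [b mb]]; have [[b' bK b'K] _ _] := mb.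
apply/step3_equivP; split; first by rewrite cellrel_sym.
by exists b'; apply: match_inv mb.
Qed.

Lemma step3_equiv_trans (c d e : cell) : @step3_equiv _ _ _ _ S c d ->
  @step3_equiv _ _ _ _ S d e -> @step3_equiv _ _ _ _ S c e.
Proof.
move=> /step3_equivP[cd [b mb]] /step3_equivP[de [b' mb']].
apply/step3_equivP; split; first exact: cellrel_trans de.
by exists (b' \o b); apply: match_comp.
Qed.

(** The indexings of an input class are made consistent by transporting one
    indexing of a chosen representative along matches. *)
Lemma consistent_indexings : exists K : forall c, seq {set inp c},
  (forall c, indexing (K c)) /\
  forall c d, @step3_equiv _ _ _ _ S c d -> consistent (K c) (K d).
Proof.
pose rep (c : cell) := odflt c [pick d | `[< @step3_equiv _ _ _ _ S c d >]].
have repP c : @step3_equiv _ _ _ _ S (rep c) c.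
  rewrite /rep; case: pickP => [d /asboolP|_] /=; first exact: step3_equiv_sym.
  exact: step3_equiv_refl.
have rep_eq c d : @step3_equiv _ _ _ _ S c d -> rep c = rep d.
  move=> cd; rewrite /rep.
  rewrite (@eq_pick _ _ [pred e | `[< @step3_equiv _ _ _ _ S d e >]]).
    case: pickP => //= /(_ d) /asboolP[]; exact: step3_equiv_refl.
  move=> e /=; apply/asboolP/asboolP; apply: step3_equiv_trans => //.
  exact: step3_equiv_sym.
pose K0 (c : cell) := enum (exch_parts S c).
have [K KP] : exists K : forall c, seq {set inp c}, forall c,
    exists2 b : inp (rep c) -> inp c, input_match b &
      K c = [seq b @: X | X : {set inp (rep c)} <- K0 (rep c)].
  suff KP c : {Kc | exists2 b : inp (rep c) -> inp c, input_match b &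
      Kc = [seq b @: X | X : {set inp (rep c)} <- K0 (rep c)]}.
    by exists (fun c => sval (KP c)) => c; exact: (svalP (KP c)).
  apply: cid; have [_ [b mb]] := (step3_equivP _ _).1 (repP c).
  by exists [seq b @: X | X : {set inp (rep c)} <- K0 (rep c)], b.
exists K; split=> [c|c d cd].
  have [b mb ->] := KP c.
  by have [rc _] := repP c; exact: match_indexing (indexing_enum _).
have [b mb ->] := KP c; have := KP d; rewrite -(rep_eq _ _ cd) => -[b' mb' ->].
have [[b1 bK b1K] _ _] := mb; have [rc _] := repP c; have [cd' _] := cd.
have cr : c ~ rep c by rewrite cellrel_sym.
have -> : [seq b' @: X | X : {set inp (rep c)} <- K0 (rep c)] =
    [seq (b' \o b1) @: X | X : {set inp c} <-
      [seq b @: X | X : {set inp (rep c)} <- K0 (rep c)]].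
  rewrite -map_comp; apply: eq_map => X /=; rewrite -imset_comp.
  by apply: eq_imset => x /=; rewrite bK.
apply: match_consistent => //; last exact: match_indexing (indexing_enum _).
apply: match_comp (match_inv rc bK b1K mb) mb' => //.
exact: cellrel_trans cd'.
Qed.

End Matching.

(** * The graphs of the four steps *)

Section Steps.
Variables (R : realType) (n : nat) (f : 'rV[R]_n -> 'rV[R]_n).
Variables (D : step1_choice f) (S : arrow_set D).

Local Notation inp c := (inputs (@arrow_head _ _ _ _ S) c).
Local Notation tl := (@arrow_tail _ _ _ _ S).
Local Notation hd := (@arrow_head _ _ _ _ S).
Local Notation gen c := (@arrow_gen R n f D S c).
Local Notation "x ~ y" := (@cellrel _ _ _ D x y) (at level 70).

Lemma arrow_input c (e : arrows S) : hd e = c -> exists a : inp c, e = val a.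
Proof. by move=> <-; exists (input_of hd e). Qed.

Lemma arrow_inputE (e : arrows S) : exists c (a : inp c), e = val a.
Proof. by exists (hd e), (input_of hd e). Qed.

Lemma step2_inputs (r2 : rel (arrows S)) : step2 r2 ->
  (forall c (a b : inp c), r2 (val a) (val b) = exch a b) /\
  (forall e e', r2 e e' -> hd e = hd e').
Proof.
move=> /step2P rP; split=> [c a b|e e' /rP[c [a [b [-> -> _]]]]]; last first.
  by rewrite !input_head.
apply/idP/idP => [/rP[c' [a' [b' [aa bb]]]]|ab]; last first.
  by apply/rP; exists c, a, b.
have ? : c' = c by rewrite -(input_head a') -aa input_head.
by subst c'; rewrite (val_inj aa) (val_inj bb).
Qed.

Lemma step2_exists : exists r2 : rel (arrows S), step2 r2.
Proof.
exists (fun e e' => `[< exists c (a b : inp c),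
  [/\ e = val a, e' = val b & exch a b] >]).
by apply/step2P => e e'; split=> /asboolP.
Qed.

Lemma step3_exists : exists r3 : rel (arrows S), step3 r3.
Proof.
have [K [iK cK]] := @consistent_indexings _ _ _ _ S.
exists (fun e e' => `[< @step3_equiv _ _ _ _ S (hd e) (hd e') /\
  exists i, input_of hd e \in indexed_part (K (hd e)) i /\
            input_of hd e' \in indexed_part (K (hd e')) i >]).
exists K; split=> // c d a b.
move: c a d b; apply: inputs_ind => e; apply: inputs_ind => e' /=.
by split=> /asboolP.
Qed.

Lemma step4_exists (r3 : rel (arrows S)) :
  network_graph (realization_graph r3) -> step4 r3 r3.
Proof. by move=> h; split. Qed.

Lemma step1_network : network_graph (realization_graph (@step1_rel _ _ _ _ S)).
Proof.
split; first exact: cellrel_equiv.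
  by move=> x y z; rewrite /= /step1_rel; split=> // /eqP->.
by move=> e e' /eqP-> /=; rewrite !cellrel_refl.
Qed.

Lemma step2_network (r2 : rel (arrows S)) :
  step2 r2 -> network_graph (realization_graph r2).
Proof.
case/step2_inputs => rE rhd; split; first exact: cellrel_equiv.
  have sy : symmetric r2.
    suff h e e' : r2 e e' -> r2 e' e by move=> e e'; apply/idP/idP; apply: h.
    move=> ee'; have := ee'; have := esym (rhd _ _ ee').
    have [c [a ->]] := arrow_inputE e; rewrite input_head => /arrow_input[b ->].
    by rewrite !rE exch_sym.
  have rr : reflexive r2.
    by move=> e; have [c [a ->]] := arrow_inputE e; rewrite rE exch_refl.
  suff tr : transitive r2 by exact: equivalence_relI.
  move=> e' e e'' ee' e'e''; have := e'e''; have := ee'.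
  have := rhd _ _ ee'; have := esym (rhd _ _ e'e'').
  have [c [a ->]] := arrow_inputE e'; rewrite input_head.
  move=> /arrow_input[b ->] /arrow_input[d ->]; rewrite !rE.
  exact: exch_trans.
move=> e e' /= ee'; rewrite (rhd _ _ ee') cellrel_refl; split=> //.
have := ee'; have := rhd _ _ ee'.
have [c [a ->]] := arrow_inputE e'; rewrite input_head => /arrow_input[b ->].
by rewrite !rE; exact: exch_tail.
Qed.

Lemma step3_same_head (r3 : rel (arrows S)) c (a b : inp c) :
  step3 r3 -> r3 (val a) (val b) <-> exch a b.
Proof.
case=> K [iK cK rK]; apply: (iff_trans (rK _ _ _ _)).
have [i ai] := indexed_part_ex a (iK c).
split=> [[_ [j [aj bj]]]|ab]; first by rewrite -(indexed_part_exch _ (iK c) aj).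
split; first exact: step3_equiv_refl.
by exists i; split=> //; rewrite (indexed_part_exch _ (iK c) ai).
Qed.

Lemma step3_network (r3 : rel (arrows S)) :
  step3 r3 -> network_graph (realization_graph r3).
Proof.
case=> K [iK cK rK]; split; first exact: cellrel_equiv.
  apply: equivalence_relI => [e|e e'|e' e e''] /=.
  - have [ca [a ->]] := arrow_inputE e; apply/rK.
    split; first exact: step3_equiv_refl.
    by have [i ai] := indexed_part_ex a (iK ca); exists i.
  - have [ca [a ->]] := arrow_inputE e.
    have [cb [b ->]] := arrow_inputE e'.
    apply/idP/idP => /rK[/step3_equiv_sym h [i [? ?]]]; apply/rK.
      by split=> //; exists i.
    by split=> //; exists i.
  have [ca [a ->]] := arrow_inputE e.
  have [cb [b ->]] := arrow_inputE e'.
  have [cd [d ->]] := arrow_inputE e''.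
  move=> /rK[ab [i [ai bi]]] /rK[bd [j [bj dj]]]; apply/rK.
  split; first exact: step3_equiv_trans bd.
  by exists i; rewrite {2}(indexed_part_inj (iK _) bi bj).
move=> e e' /=; have [ca [a ->]] := arrow_inputE e.
have [cb [b ->]] := arrow_inputE e'.
move=> /rK[ab [i [ai bi]]]; rewrite !input_head; split; first by case: ab.
by have [_ _ tK _] := cK _ _ ab; apply: tK bi.
Qed.

Lemma step2_step3 (r2 r3 : rel (arrows S)) e e' :
  step2 r2 -> step3 r3 -> r2 e e' -> r3 e e'.
Proof.
move=> /step2_inputs[rE rhd] h3 ee'; have := ee'; have := rhd _ _ ee'.
have [c [b ->]] := arrow_inputE e'; rewrite input_head => /arrow_input[a ->].
rewrite rE => ab.
exact/(step3_same_head _ _ h3).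
Qed.

(** Cells without inputs are the case covered by [sources_agree]; otherwise an
    input of c is available to compare the input classes of c and d. *)
Lemma realization_admissible (r : rel (arrows S)) : sources_agree D ->
  (forall c d (b : inp c -> inp d), c ~ d -> inp c ->
     @input_iso _ (realization_graph r) c d b ->
     agree_along (gen c) (gen d) b) ->
  admissible (@cell_dim _ _ _ D) f (realization_graph r).
Proof.
move=> src agr; split; [exact: dim_sum|exact: cellrel_dim|].
exists (fun c => gen c); split=> [c x|c d b cd ib].
  rewrite gen_f /arrow_gen; congr gen_fun.
  apply: functional_extensionality_dep => v.
  by rewrite same_space_cell // var_arrow_tail.
have [a _|c0] := pickP {: inp c}; first exact: agr.
have [[b' bK b'K] _] := ib => x y; apply: src => // a.
  apply/eqP; rewrite -leqn0 leqNgt; apply/negP => h.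
  by have := c0 (var_arrow S (Tagged _ (Ordinal h) : gen_var _ c)).
apply/eqP; rewrite -leqn0 leqNgt; apply/negP => h.
by have := c0 (b' (var_arrow S (Tagged _ (Ordinal h) : gen_var _ d))).
Qed.

Lemma step1_admissible : sources_agree D ->
  admissible (@cell_dim _ _ _ D) f (realization_graph (@step1_rel _ _ _ _ S)).
Proof.
move/realization_admissible; apply => c d b cd a [_ bE].
have be a' : val (b a') = val a' by apply/esym/eqP/bE.
have ? : d = c by rewrite -(input_head (b a)) be input_head.
by subst d; apply: agree_id => a'; apply/val_inj/be.
Qed.

Lemma step2_admissible (r2 : rel (arrows S)) : step2 r2 -> sources_agree D ->
  admissible (@cell_dim _ _ _ D) f (realization_graph r2).
Proof.
move=> /step2_inputs[rE rhd] /realization_admissible.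
apply => c d b cd a [bb bE]; have ? : d = c.
  by have := rhd _ _ (bE a); rewrite !input_head.
subst d; have -> : b = perm (bij_inj bb) by apply/funext => x; rewrite permE.
by apply: exch_perm => x; rewrite permE -rE; apply: bE.
Qed.

Lemma step3_agree (r3 : rel (arrows S)) : step3 r3 ->
  forall c d (b : inp c -> inp d), c ~ d -> inp c ->
     @input_iso _ (realization_graph r3) c d b ->
     agree_along (gen c) (gen d) b.
Proof.
move=> [K [iK cK rK]] c d b cd a [bb bE].
have [cd3 _] := (rK _ _ _ _).1 (bE a).
have [_ _ _ agr] := cK _ _ cd3; apply: agr => // i x xi.
have [_ [j [xj bxj]]] := (rK _ _ _ _).1 (bE x).
by rewrite (indexed_part_inj (iK _) xi xj).
Qed.

Lemma step3_admissible (r3 : rel (arrows S)) : step3 r3 -> sources_agree D ->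
  admissible (@cell_dim _ _ _ D) f (realization_graph r3).
Proof. by move=> h3 /realization_admissible; apply; exact: step3_agree. Qed.

(** As the input equivalences agree, the merged classes give no new elements of
    B(c,d). *)
Lemma step4_admissible (r4 : rel (arrows S)) : step4_result r4 ->
  sources_agree D ->
  admissible (@cell_dim _ _ _ D) f (realization_graph r4).
Proof.
move=> [r3 [h3 [_ _ r43 eq43]]] /realization_admissible; apply.
move=> c d b cd a [bb bE]; apply: (step3_agree h3) => //; split=> // x.
apply: r43; first exact: bE.
by rewrite !input_head; apply/eq43; split=> //; exists b.
Qed.

End Steps.

(** * Linear admissible vector fields *)

Section InputEquivalence.
Variables (C : finType) (G : network C).
Hypothesis G_graph : network_graph G.

Lemma input_equiv_refl c : input_equiv G c c.
Proof.
have [/equivalence_relP[cr _] /equivalence_relP[er _] _] := G_graph.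
by split; [exact: cr|exists id; split; [exists id|]].
Qed.

Lemma input_equiv_sym c d : input_equiv G c d -> input_equiv G d c.
Proof.
have [/equivalence_relP[cr ct] /equivalence_relP[er et] _] := G_graph.
case=> cd [b [[b' bK b'K] bE]]; split; first by rewrite -(ct _ _ cd) cr.
exists b'; split; first by exists b.
by move=> e; have := bE (b' e); rewrite b'K => h; rewrite -(et _ _ h) er.
Qed.

Lemma input_equiv_trans c d e :
  input_equiv G c d -> input_equiv G d e -> input_equiv G c e.
Proof.
have [/equivalence_relP[_ ct] /equivalence_relP[_ et] _] := G_graph.
move=> [cd [b [bb bE]]] [de [b' [bb' bE']]]; split.
  by rewrite (ct _ _ cd).
exists (b' \o b); split; first exact: bij_comp.
by move=> a /=; rewrite (et _ _ (bE a)).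
Qed.

End InputEquivalence.

(** The weight w e is the entry, at the head of e, of the coefficient of the
    class of e. Conversely, the coefficient of a class at the cell i is read off
    from any arrow of the class whose head is input-equivalent to i. Thus only
    the pairs of equivalent arrows with input-equivalent heads matter, which are
    the same before and after the merging of Step 4. *)
Lemma linear_admissibleP (R : realType) n0 (G : network 'I_n0) (M : 'M[R]_n0) :
  network_graph G ->
  linear_admissible R G M <->
  exists (t : 'I_n0 -> R) (w : arrow G -> R),
    [/\ forall i j, input_equiv G i j -> t i = t j,
        forall e e', simE e e' -> input_equiv G (head_of e) (head_of e') ->
          w e = w e'
      & forall i j, M i j = t i *+ (i == j) +
          \sum_(e | (tail_of e == j) && (head_of e == i)) w e].
Proof.
move=> hG; have [_ eG _] := hG; have [er el] := (equivalence_relP _).1 eG.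
have part : finset.partition (arrow_classes G) [set: arrow G]%SET.
  by apply: equivalence_partitionP => x y z _ _ _; apply: eG.
pose cl (e : arrow G) := [set e' in [set: arrow G] | simE e e']%SET.
have clG e : cl e \in arrow_classes G by exact: imset_f.
have memcl xi e : xi \in arrow_classes G -> e \in xi -> xi = cl e.
  move=> /imsetP[e0 _ ->]; rewrite !inE /= => h.
  by apply/setP => x; rewrite !inE /= (el _ _ h).
have clE e e' : simE e e' -> cl e = cl e'.
  by move=> h; apply/setP => x; rewrite !inE /= (el _ _ h).
have entry (t : 'rV[R]_n0) (s : {set arrow G} -> 'rV[R]_n0) (w : arrow G -> R)
    i j : (forall e, head_of e = i -> w e = s (cl e) 0 i) ->
    (diag_mx t + \sum_(xi in arrow_classes G) diag_mx (s xi) *m adjacency R xi)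
      i j = t 0 i *+ (i == j) +
          \sum_(e | (tail_of e == j) && (head_of e == i)) w e.
  move=> ws; rewrite !mxE summxE; congr (_ + _).
  transitivity (\sum_(e in [set: arrow G]%SET |
      (tail_of e == j) && (head_of e == i)) w e); last first.
    by apply: eq_bigl => e; rewrite inE.
  rewrite (set_partition_big_cond _ part); apply: eq_bigr => xi xiG.
  rewrite mul_diag_mx !mxE mulr_natr -sumr_const.
  apply: eq_big => [e|e]; rewrite !inE //.
  by move=> /andP[exi /andP[_ /eqP he]]; rewrite ws // -(memcl xi).
split=> [[t [s [ts ->]]]|[t [w [tE wE ME]]]].
  exists (fun i => t 0 i), (fun e => s (cl e) 0 (head_of e)); split.
  - by move=> i j /ts[].
  - by move=> e e' /clE -> /ts[_]; apply.
  - by move=> i j; apply: entry => e ->.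
(* A class without such an arrow has a zero i-th row in its adjacency matrix,
   whatever the coefficient. *)
pose s (xi : {set arrow G}) : 'rV[R]_n0 := \row_i
  (if [pick e in xi | `[< input_equiv G (head_of e) i >]] is Some e
   then w e else 0).
exists (\row_i t i), s; split.
  move=> i j ij; split; first by rewrite !mxE (tE _ _ ij).
  move=> xi _; rewrite !mxE; congr (if _ is Some e then _ else _).
  apply: eq_pick => e; congr (_ && _); apply/asboolP/asboolP => h.
    exact: input_equiv_trans ij.
  exact: input_equiv_trans (input_equiv_sym hG ij).
apply/matrixP => i j; rewrite ME (entry _ s w) ?mxE // => e he.
rewrite mxE; case: pickP => [e' /andP[]|/(_ e)].
  rewrite !inE /= => ee' h; apply: wE => //.
  by rewrite he; apply: (input_equiv_sym hG); exact: h.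
rewrite /= !inE /= er he; case: asboolP => // -[].
exact: input_equiv_refl.
Qed.

(** A finer arrow relation has fewer input isomorphisms, hence also a finer
    input equivalence, and leaves fewer constraints on the weights. *)
Lemma linear_admissible_sub (R : realType) n (f : 'rV[R]_n -> 'rV[R]_n)
    (D : step1_choice f) (S : arrow_set D) (r r' : rel (arrows S)) :
  network_graph (realization_graph r) -> network_graph (realization_graph r') ->
  (forall e e', r e e' -> r' e e') ->
  (linear_admissible R (realization_graph r') `<=`
   linear_admissible R (realization_graph r))%classic.
Proof.
move=> gr gr' rr' M /(linear_admissibleP _ gr')[t [w [tE wE ME]]].
have eqv c d : input_equiv (realization_graph r) c d ->
    input_equiv (realization_graph r') c d.
  by move=> [cd [b [bb bE]]]; split=> //; exists b; split=> // e; exact/rr'/bE.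
apply/(linear_admissibleP _ gr); exists t, w; split=> //.
  by move=> i j /eqv; apply: tE.
by move=> e e' /rr' h /eqv; apply: wE.
Qed.

(** The pairs of arrows related only after the merging have heads that are not
    input-equivalent and put no constraint on the weights. *)
Lemma step4_linear_admissible (R : realType) n (f : 'rV[R]_n -> 'rV[R]_n)
    (D : step1_choice f) (S : arrow_set D) (r3 r4 : rel (arrows S)) :
  step3 r3 -> step4 r3 r4 ->
  linear_admissible R (realization_graph r4) =
  linear_admissible R (realization_graph r3).
Proof.
move=> /step3_network g3 [g4 r34 r43 eqv]; apply/seteqP; split.
  exact: linear_admissible_sub.
move=> M /(linear_admissibleP _ g3)[t [w [tE wE ME]]].
apply/(linear_admissibleP _ g4); exists t, w; split=> //.
  by move=> i j /eqv; apply: tE.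
by move=> e e' h /eqv he; apply: wE => //; apply: r43.
Qed.

(** * Independence of the choice of the arrows *)

Section Relabelling.
Variables (R : realType) (n : nat) (f : 'rV[R]_n -> 'rV[R]_n).
Variable D : step1_choice f.

Local Notation cell := 'I_(ncell D).
Local Notation inp S := (inputs (arrow_head (a:=S))).
Local Notation state S :=
  (input_state R (cell_dim (s:=D)) (arrow_head (a:=S)) (arrow_tail (a:=S))).

(** The variables of the generating functions are the only data that two arrow
    sets have in common, so arrows are compared through them. *)
Lemma relabelling (S S' : arrow_set D) :
  exists h : forall c : cell, inp S c -> inp S' c,
  forall c v, h c (var_arrow S (c:=c) v) = var_arrow S' v.
Proof.
suff hP (c : cell) : {h : inp S c -> inp S' c |
    forall v, h (var_arrow S (c:=c) v) = var_arrow S' v}.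
  by exists (fun c => sval (hP c)) => c; exact: (svalP (hP c)).
apply: cid; have [g gK _] := var_arrow_bij S c.
by exists (fun a => var_arrow S' (g a)) => v; rewrite gK.
Qed.

Section Transport.
Variables S S' : arrow_set D.
Variable h : forall c : cell, inp S c -> inp S' c.
Hypothesis hE : forall c v, h (var_arrow S (c:=c) v) = var_arrow S' v.

Lemma var_arrow_onto (T : arrow_set D) c (a : inp T c) :
  exists v, a = var_arrow T v.
Proof. by have [g _ gK] := var_arrow_bij T c; exists (g a). Qed.

Lemma relabel_inj c : injective (@h c).
Proof.
move=> a b; have [v ->] := var_arrow_onto a; have [w ->] := var_arrow_onto b.
by rewrite !hE => /(bij_inj (var_arrow_bij S' c)) ->.
Qed.

Lemma relabel_tail c (a : inp S c) :
  arrow_tail (val (h a)) = arrow_tail (val a).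
Proof. by have [v ->] := var_arrow_onto a; rewrite hE !var_arrow_tail. Qed.

Lemma relabel_exch c (a b : inp S c) :
  exch a b -> exch (h a) (h b).
Proof.
move=> /exchP[t g]; apply/exchP; rewrite !relabel_tail; split=> // x y.
have genE z (z' : state S' c) :
    arrow_gen z z' =
    arrow_gen z ((fun e => same_space _ (z' (h e))) : state S c).
  rewrite /arrow_gen; congr gen_fun; apply: functional_extensionality_dep => v.
  by rewrite same_space_comp ?relabel_tail // hE.
rewrite !genE (g x); congr (same_space _ (arrow_gen _ _)).
apply: functional_extensionality_dep => e; rewrite /input_pullback.
rewrite -(inj_tperm _ _ _ (relabel_inj (c:=c))).
rewrite same_space_comp ?relabel_tail //.
rewrite [in RHS]same_space_comp // relabel_tail.
by apply/esym/cellrel_dim; rewrite relabel_tail; exact: tperm_tail.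
Qed.

End Transport.

(** Arrows with different heads are unrelated on both sides, so the relations
    need to be compared only within the inputs of one cell. *)
Lemma relabel_isomorphic (S S' : arrow_set D) (r : rel (arrows S))
    (r' : rel (arrows S')) :
  (forall e e', r e e' -> arrow_head e = arrow_head e') ->
  (forall e e', r' e e' -> arrow_head e = arrow_head e') ->
  (forall (h : forall c : cell, inp S c -> inp S' c),
    (forall c v, h c (var_arrow S (c:=c) v) = var_arrow S' v) ->
    forall c (a b : inp S c),
      r' (val (h c a)) (val (h c b)) = r (val a) (val b)) ->
  isomorphic (realization_graph r) (realization_graph r').
Proof.
move=> rhd rhd' rr'.
have [h hE] := relabelling S S'; have [k kE] := relabelling S' S.
have hK (c : cell) : cancel (h c) (k c).
  by move=> a; have [v ->] := var_arrow_onto a; rewrite hE kE.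
have kK (c : cell) : cancel (k c) (h c).
  by move=> a; have [v ->] := var_arrow_onto a; rewrite kE hE.
pose H (e : arrows S) : arrows S' := val (h _ (input_of (arrow_head (a:=S)) e)).
pose K (e : arrows S') : arrows S :=
  val (k _ (input_of (arrow_head (a:=S')) e)).
have HE (c : cell) (a : inp S c) : H (val a) = val (h c a).
  by move: c a; apply: inputs_ind.
have KE (c : cell) (a : inp S' c) : K (val a) = val (k c a).
  by move: c a; apply: inputs_ind.
have Hhd e : arrow_head (H e) = arrow_head e by rewrite input_head.
exists id, H; split=> //.
- split; first by exists id.
  exists K => e.
    by have [c [a ->]] := arrow_inputE e; rewrite HE KE hK.
  by have [c [a ->]] := arrow_inputE e; rewrite KE HE kK.
- by move=> e /=; rewrite relabel_tail.
move=> e e' /=; have [ee'|ne] := eqVneq (arrow_head e') (arrow_head e).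
  have := ee'; have [c [a ->]] := arrow_inputE e; rewrite input_head.
  by move=> /arrow_input[b ->]; rewrite !HE rr'.
apply/idP/idP => [/rhd'|/rhd] /esym /eqP; rewrite ?Hhd => /eqP E.
  by rewrite E eqxx in ne.
by rewrite E eqxx in ne.
Qed.

Lemma step1_isomorphic (S S' : arrow_set D) :
  isomorphic (realization_graph (@step1_rel _ _ _ _ S))
             (realization_graph (@step1_rel _ _ _ _ S')).
Proof.
apply: relabel_isomorphic => [e e' /eqP->|e e' /eqP->|h hE c a b] //.
by rewrite /step1_rel !(inj_eq val_inj) (inj_eq (relabel_inj hE (c:=c))).
Qed.

Lemma step2_isomorphic (S S' : arrow_set D) (r2 : rel (arrows S))
    (r2' : rel (arrows S')) : step2 r2 -> step2 r2' ->
  isomorphic (realization_graph r2) (realization_graph r2').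
Proof.
move=> /step2_inputs[rE rhd] /step2_inputs[rE' rhd'].
apply: relabel_isomorphic => // h hE c a b; rewrite rE rE'.
apply/idP/idP; last exact: relabel_exch.
have [k kE] := relabelling S' S; move/(relabel_exch kE).
have hK x : k c (h c x) = x by have [v ->] := var_arrow_onto x; rewrite hE kE.
by rewrite !hK.
Qed.

Lemma arrow_set_exists : inhabited (arrow_set D).
Proof.
pose V := gen_var (@multiplicity _ _ _ D).
pose A : finType := {c : cell & V c}.
pose hA (e : A) : cell := projT1 e.
pose tA (e : A) : cell := tag (projT2 e).
pose vA (c : cell) (v : V c) : inputs hA c := exist _ (Tagged V v) (eqxx c).
suff vAb c : bijective (@vA c) by constructor; exists A hA tA vA.
exists (fun a : inputs hA c => etagged (eqP (valP a) : tag (val a) = c)).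
  by move=> v; rewrite /= (eq_axiomK (eqP _)).
move=> a; move: c a; apply: inputs_ind => -[c v]; apply: val_inj => /=.
by rewrite (eq_axiomK (eqP _)).
Qed.

End Relabelling.

(** * Two final graphs that are not isomorphic *)

Section Example.
Variable R : realType.

(** With two inputs of one cell and four of the other, the cells cannot become
    input-equivalent, so that all arrows may be merged into one class. *)
Definition sum_mult (c d : 'I_2) : nat := c.+1.

Definition sum_dim (c : 'I_2) : nat := 1%N.

Local Notation dim := (\sum_(c < 2) sum_dim c)%N.

Definition sum_gen (c : 'I_2) (x : 'rV[R]_(sum_dim c))
    (y : forall v : gen_var sum_mult c, 'rV[R]_(sum_dim (tag v))) :
    'rV[R]_(sum_dim c) := \sum_v (y v : 'rV[R]_1).

Definition sum_field (x : 'rV[R]_dim) : 'rV[R]_dim :=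
  \mxrow_(c < 2) sum_gen (0 : 'rV[R]_(sum_dim c))
                   (fun v => cell_state sum_dim (tag v) x).

Lemma sum_field_C1 : C1_map sum_field.
Proof.
have lin : linear sum_field.
  move=> a x y; apply/matrixP => i j.
  rewrite !mxE /sum_gen !summxE mulr_sumr -big_split; apply: eq_bigr => v _ /=.
  by rewrite /cell_state /same_space !conform_mx_id !mxE.
have diff x : differentiable sum_field x.
  have -> : sum_field =
      \sum_(j < dim) (fun x => sum_field x 0 j *: delta_mx 0 j).
    apply/funext => z; rewrite fct_sumE {1}[sum_field z]matrix_sum_delta.
    by rewrite big_ord1.
  apply: differentiable_sum => j; apply: differentiableZl.
  have -> : (fun z => sum_field z 0 j) =
      \sum_(v : gen_var sum_mult (tagnat.sig1 j))
        (fun z : 'rV[R]_dim => z 0 (tagnat.Rank (tag v) (tagnat.sig2 j))).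
    apply/funext => z; rewrite fct_sumE !mxE /sum_gen summxE.
    apply: eq_bigr => v _; rewrite /cell_state /same_space conform_mx_id.
    by rewrite !mxE.
  apply: (big_ind (fun g => differentiable g x)) => [|g h dg dh|v _].
  - exact: differentiable_cst.
  - exact: differentiableD.
  - exact: differentiable_coord.
split=> // v.
pose F : {linear 'rV[R]_dim -> 'rV[R]_dim} :=
  HB.pack sum_field (GRing.isLinear.Build _ _ _ _ _ lin).
have -> : (fun x => 'd sum_field x v) = cst (sum_field v).
  apply/funext => x; rewrite (@diff_lin _ _ _ F) // => z.
  exact: differentiable_continuous.
exact: cst_continuous.
Qed.

Lemma sum_gen_dfwith c (v : gen_var sum_mult c) x y :
  (fun u => sum_gen (c:=c) x (dfwith y v u)) =
  id + cst (\sum_(w | w != v) (y w : 'rV[R]_1)) :> ('rV[R]_1 -> 'rV[R]_1).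
Proof.
apply/funext => u; rewrite /sum_gen (bigD1 v) //= dfwithin; congr (_ + _).
by apply: eq_bigr => w wv; rewrite dfwithout // eq_sym.
Qed.

Lemma sum_gen_diff c (v : gen_var sum_mult c) x y
    (u : 'rV[R]_(sum_dim (tag v))) :
  is_diff u (fun u : 'rV[R]_(sum_dim (tag v)) =>
    sum_gen (c:=c) x (dfwith y v u)) id.
Proof.
rewrite sum_gen_dfwith.
by apply: is_diff_eq; apply/funext => w; rewrite addr0.
Qed.

Lemma sum_gen_differentiable c (v : gen_var sum_mult c) x y :
  differentiable (fun u : 'rV[R]_(sum_dim (tag v)) =>
    sum_gen (c:=c) x (dfwith y v u)) (y v).
Proof. by have := sum_gen_diff x y (y v) (v:=v). Qed.

Lemma sum_gen_dep c (v : gen_var sum_mult c) :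
  exists x y (w : 'rV[R]_(sum_dim (tag v))),
    'd (fun u : 'rV[R]_(sum_dim (tag v)) =>
      sum_gen (c:=c) x (dfwith y v u)) (y v) w != 0.
Proof.
exists 0, (fun=> 0), (const_mx 1).
have dg := sum_gen_diff 0 (fun=> 0) 0 (v:=v); rewrite diff_val.
by apply/eqP => /matrixP /(_ 0 0); rewrite !mxE; apply/eqP/oner_neq0.
Qed.

Lemma sum_gen_field c x : cell_state sum_dim c (sum_field x) =
  sum_gen (cell_state sum_dim c x) (fun v => cell_state sum_dim (tag v) x).
Proof. by rewrite {1}/cell_state /same_space conform_mx_id mxrowK. Qed.

Definition sum_choice : step1_choice sum_field :=
  @Step1Choice R dim sum_field 2 sum_dim (fun=> isT) erefl (fun _ _ => true)
    (fun _ _ _ => conj erefl (fun=> erefl)) (fun _ _ _ => erefl)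
    sum_mult sum_gen sum_gen_differentiable sum_gen_dep sum_gen_field.

Variable S : arrow_set sum_choice.
Local Notation inp c := (inputs (arrow_head (a:=S)) c).

Lemma sum_arrow_gen (c : 'I_2) x y :
  arrow_gen (S:=S) (c:=c) x y = \sum_(a : inp c) same_space 1 (y a).
Proof.
rewrite (reindex (var_arrow S (c:=c))) //=.
exact/onW_bij/(var_arrow_bij S c).
Qed.

Lemma sum_exch (c : 'I_2) (a b : inp c) : exch a b.
Proof.
apply/exchP; split=> // x y.
rewrite !sum_arrow_gen same_space_id.
rewrite (reindex_inj (@perm_inj _ (tperm a b))); apply: eq_bigr => e _.
by rewrite /input_pullback same_space_comp.
Qed.

Lemma sum_card (c : 'I_2) : #|{: inp c}| = (2 * c.+1)%N.
Proof.
rewrite -(bij_eq_card (var_arrow_bij S c)) card_tagged sumnE big_map.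
rewrite big_enum (eq_bigr (fun=> c.+1)) => [|d _]; last exact: card_ord.
by rewrite sum_nat_const card_ord.
Qed.

Lemma sum_inputs_bij (c d : 'I_2) (b : inp c -> inp d) : bijective b -> c = d.
Proof.
move/bij_eq_card; rewrite !sum_card => /eqP; rewrite eqn_mul2l eqSS /= => /eqP.
exact: val_inj.
Qed.

Lemma sum_input_equiv (r : rel (arrows S)) c d :
  input_equiv (realization_graph r) c d -> c = d.
Proof. by case=> _ [b [/sum_inputs_bij]]. Qed.

Lemma sum_step4_full (r3 : rel (arrows S)) :
  step3 r3 -> step4 r3 (fun _ _ => true).
Proof.
move=> h3; have g3 := step3_network h3.
have g4 : network_graph (realization_graph (fun _ _ : arrows S => true)).
  by split=> // [e e' e''|e e' _]; split.
split=> // [e e' _|c d].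
  move=> /sum_input_equiv ee'.
  have [c [a ea]] := arrow_inputE e; move: ee'; rewrite ea input_head => /esym.
  move=> /(@arrow_input _ _ _ _ S)[a' ->].
  exact/(step3_same_head _ _ h3)/sum_exch.
by split=> /sum_input_equiv ->; exact: input_equiv_refl.
Qed.

Lemma sum_not_isomorphic (r3 : rel (arrows S)) : step3 r3 ->
  ~ isomorphic (realization_graph r3)
      (realization_graph (fun _ _ : arrows S => true)).
Proof.
move=> [K [iK cK rK]] [g [h [_ _ _ _ hr]]].
pose a (c : 'I_2) : inp c := var_arrow S (c:=c)
  (existT (fun d : 'I_2 => 'I_(sum_mult c d)) ord0 (ord0 : 'I_c.+1)).
have /rK[/step3_equivP[_ [b []]] + _] : r3 (val (a ord0)) (val (a ord_max)).
  by have := hr (val (a ord0)) (val (a ord_max)).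
by move=> /sum_inputs_bij.
Qed.

End Example.

(** * The realization procedure *)

Theorem theorem4p2 (R : realType) :
  (forall (n : nat) (f : 'rV[R]_n -> 'rV[R]_n) (D : step1_choice f), C1_map f ->
    (* the procedure can be carried out *)
    [/\ inhabited (arrow_set D),
        forall S : arrow_set D, exists r2 : rel (arrows S), step2 r2,
        forall S : arrow_set D, exists r3 : rel (arrows S), step3 r3
      & forall (S : arrow_set D) (r3 : rel (arrows S)),
          step3 r3 -> exists r4 : rel (arrows S), step4 r3 r4] /\
    (* it yields network graphs that are admissible for f *)
    (forall (S : arrow_set D) (r : rel (arrows S)),
       [\/ r = @step1_rel _ _ _ _ S, step2 r, step3 r | step4_result r] ->
       network_graph (realization_graph r) /\
       (sources_agree D ->
        admissible (@cell_dim _ _ _ D) f (realization_graph r))) /\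
    (* uniqueness of G_1 and G_2 up to isomorphism *)
    (forall S S' : arrow_set D,
       isomorphic (realization_graph (@step1_rel _ _ _ _ S))
                  (realization_graph (@step1_rel _ _ _ _ S')) /\
       forall (r2 : rel (arrows S)) (r2' : rel (arrows S')),
         step2 r2 -> step2 r2' ->
         isomorphic (realization_graph r2) (realization_graph r2')) /\
    (* each G_4 is ODE-equivalent to some G_3 *)
    (forall (S : arrow_set D) (r4 : rel (arrows S)), step4_result r4 ->
       exists r3 : rel (arrows S), step3 r3 /\
         ODE_equivalent R (realization_graph r4) (realization_graph r3)) /\
    (* the spaces of linear admissible vector fields *)
    (forall (S : arrow_set D) (r2 r3 r4 : rel (arrows S)),
       step2 r2 -> step3 r3 -> step4 r3 r4 ->
       [/\ linear_admissible R (realization_graph r4) =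
             linear_admissible R (realization_graph r3),
           (linear_admissible R (realization_graph r3) `<=`
             linear_admissible R (realization_graph r2))%classic
         & (linear_admissible R (realization_graph r2) `<=`
             linear_admissible R
               (realization_graph (@step1_rel _ _ _ _ S)))%classic]))
  /\
  (* two graphs G_4 for the same f and the same choices may be non-isomorphic *)
  (exists (n : nat) (f : 'rV[R]_n -> 'rV[R]_n) (D : step1_choice f)
      (S : arrow_set D) (r4 r4' : rel (arrows S)),
    [/\ C1_map f /\ sources_agree D, step4_result r4, step4_result r4'
      & ~ isomorphic (realization_graph r4) (realization_graph r4')]).
Proof.
split=> [n f D _|]; last first.
  have [S] := arrow_set_exists (sum_choice R).
  have [r3 h3] := step3_exists S.
  exists _, (@sum_field R), (sum_choice R), S, r3, (fun _ _ => true); split.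
  - by split=> [|c d _ /(_ ord0)//]; exact: sum_field_C1.
  - by exists r3; split=> //; apply/step4_exists/step3_network.
  - by exists r3; split=> //; exact: sum_step4_full.
  - exact: sum_not_isomorphic.
split; first split.
- exact: arrow_set_exists.
- exact: step2_exists.
- exact: step3_exists.
- by move=> S r3 h3; exists r3; apply/step4_exists/step3_network.
split=> [S r|].
  case=> [->|h2|h3|h4].
  - by split; [exact: step1_network|exact: step1_admissible].
  - by split; [exact: step2_network|exact: step2_admissible].
  - by split; [exact: step3_network|exact: step3_admissible].
  - by split; [case: h4 => r3 [_ []]|exact: step4_admissible].
split=> [S S'|].
  by split=> [|r2 r2']; [exact: step1_isomorphic|exact: step2_isomorphic].
split=> [S r4 [r3 [h3 h34]]|S r2 r3 r4 h2 h3 h34].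
  exists r3; split=> //; exists 1%g; split=> [c d|].
    by rewrite !perm1; have [_ _ _ ->] := h34.
  rewrite (step4_linear_admissible h3 h34) /cell_perm_mx perm_mx1 !trmx1.
  apply/seteqP; split=> [M LM|_ [M LM <-]]; last by rewrite mul1mx mulmx1.
  by exists M => //; rewrite mul1mx mulmx1.
split; first exact: step4_linear_admissible.
- apply: linear_admissible_sub => [||e e'].
  + exact: step2_network.
  + exact: step3_network.
  + exact: step2_step3.
- apply: linear_admissible_sub => [||e e' /eqP->].
  + exact: step1_network.
  + exact: step2_network.
  + by have [_ /equivalence_relP[rr _] _] := step2_network h2; exact: rr.
Qed.
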